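(* Let $r\ge1$, $\ell\ge1$, and let $\mathcal{C}$ be the set of compositions $d=(d_1,\ldots,d_r)$ of $\ell$ into $r$ nonnegative parts. For $d\in\mathcal{C}$ and $n\ge0$ let $f_{n,d}(q)$ be the generating function $\sum q^{|\Lambda|}$ of cylindric partitions with profile $d$ and all parts at most $n$, and put $P_{n,d}(q)=(q^r;q^r)_nf_{n,d}(q)$. Fix $c\in\mathcal{C}$ and let $f_{=n,c}(q)$ be the generating function $\sum q^{|\Lambda|}$ of cylindric partitions $\Lambda$ with profile $c$ and $\max(\Lambda)=n$. Then $f_{=n,c}(q)=P_{=n,c}(q)/(q^r;q^r)_n$, where $P_{=0,c}(q)=1$ and, for $n\ge1$, \[ P_{=n,c}(q)=q^{nr}P_{n-1,c}(q)+\sum_{d\in\mathcal{C},\,d\ne c}q^{n\Delta(c,d)}P_{n-1,d}(q). \]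
   Context: A cylindric partition with profile $c=(c_1,\ldots,c_r)$ is a tuple $\Lambda=(\lambda^{(1)},\ldots,\lambda^{(r)})$ of integer partitions such that for all $j\ge1$: $\lambda^{(i)}_j\ge\lambda^{(i+1)}_{j+c_{i+1}}$ for $1\le i\le r-1$, and $\lambda^{(r)}_j\ge\lambda^{(1)}_{j+c_1}$ (missing parts taken as $0$); $|\Lambda|$ is the sum of all parts and $\max(\Lambda)$ the largest part ($0$ for the empty one). For compositions $c,d$ with $r$ parts, $\Delta(c,d)=\sum_{k=2}^{r}(k-1)(d_k-c_k)+r\max\{0,\ c_r-d_r,\ (c_r+c_{r-1})-(d_r+d_{r-1}),\ \ldots,\ (c_r+\cdots+c_2)-(d_r+\cdots+d_2)\}$. $(a;q)_n=\prod_{j=1}^n(1-aq^{j-1})$. *)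

(* Defs.v *)
From HB Require Import structures.
From mathcomp Require Import all_boot all_order all_algebra finmap.
From mathcomp Require Import boolp classical_sets functions cardinality.

Set Implicit Arguments.
Unset Strict Implicit.
Unset Printing Implicit Defensive.

Import Order.TTheory GRing.Theory Num.Theory.

Local Open Scope ring_scope.

Record fps (R : Type) := Fps { fcoef : nat -> R }.

Lemma fpsP (R : Type) (f g : fps R) : fcoef f =1 fcoef g -> f = g.
Proof. by case: f g => [f] [g] /= /funext ->. Qed.

HB.instance Definition _ (R : Type) := gen_eqMixin (fps R).
HB.instance Definition _ (R : Type) := gen_choiceMixin (fps R).

Definition fps_zero (R : zmodType) : fps R := Fps (fun=> 0).
Definition fps_opp (R : zmodType) (f : fps R) : fps R :=
  Fps (fun m => - fcoef f m).
Definition fps_add (R : zmodType) (f g : fps R) : fps R :=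
  Fps (fun m => fcoef f m + fcoef g m).

Lemma fps_addA (R : zmodType) : associative (@fps_add R).
Proof. by move=> f g h; apply: fpsP => m /=; rewrite addrA. Qed.
Lemma fps_addC (R : zmodType) : commutative (@fps_add R).
Proof. by move=> f g; apply: fpsP => m /=; rewrite addrC. Qed.
Lemma fps_add0 (R : zmodType) : left_id (@fps_zero R) (@fps_add R).
Proof. by move=> f; apply: fpsP => m /=; rewrite add0r. Qed.
Lemma fps_addN (R : zmodType) :
  left_inverse (@fps_zero R) (@fps_opp R) (@fps_add R).
Proof. by move=> f; apply: fpsP => m /=; rewrite addNr. Qed.

HB.instance Definition _ (R : zmodType) := GRing.isZmodule.Build (fps R)
  (@fps_addA R) (@fps_addC R) (@fps_add0 R) (@fps_addN R).

Definition fps_one (R : comUnitRingType) : fps R :=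
  Fps (fun m => (m == 0)%N%:R).
Definition fps_mul (R : comUnitRingType) (f g : fps R) : fps R :=
  Fps (fun m => \sum_(j < m.+1) fcoef f j * fcoef g (m - j)).

Definition fps_trunc (R : comUnitRingType) (N : nat) (f : fps R) : {poly R} :=
  \poly_(i < N) fcoef f i.

Lemma fcoef_mul_trunc (R : comUnitRingType) (N m : nat) (f g : fps R) :
  (m < N)%N ->
  fcoef (fps_mul f g) m = (fps_trunc N f * fps_trunc N g)`_m.
Proof.
move=> ltmN; rewrite coefM; apply: eq_bigr => j _.
by rewrite !coef_poly !(leq_ltn_trans _ ltmN) ?leq_subr // -ltnS.
Qed.

Lemma fps_mulC (R : comUnitRingType) : commutative (@fps_mul R).
Proof.
by move=> f g; apply: fpsP => m; rewrite !(@fcoef_mul_trunc R m.+1) // mulrC.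
Qed.

Lemma fps_mulA (R : comUnitRingType) : associative (@fps_mul R).
Proof.
move=> f g h; apply: fpsP => m.
pose t := @fps_trunc R m.+1.
transitivity ((t f * (t g * t h))`_m).
  rewrite coefM; apply: eq_bigr => j _.
  by rewrite /t coef_poly ltn_ord -fcoef_mul_trunc // ltnS leq_subr.
rewrite mulrA coefM; apply: eq_bigr => j _.
by rewrite -fcoef_mul_trunc // coef_poly ltnS leq_subr.
Qed.

Lemma fps_mul1 (R : comUnitRingType) : left_id (@fps_one R) (@fps_mul R).
Proof.
move=> f; apply: fpsP => m /=.
by rewrite big_ord_recl /= mul1r subn0 big1 ?addr0 // => j _; rewrite mul0r.
Qed.

Lemma fps_mulDl (R : comUnitRingType) :
  left_distributive (@fps_mul R) (@fps_add R).
Proof.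
move=> f g h; apply: fpsP => m /=.
by rewrite -big_split; apply: eq_bigr => j _; rewrite /= mulrDl.
Qed.

Lemma fps_one_neq0 (R : comUnitRingType) : @fps_one R != 0.
Proof.
apply/eqP => /(congr1 (fun f => fcoef f 0%N)) /= /eqP.
by rewrite oner_eq0.
Qed.

HB.instance Definition _ (R : comUnitRingType) :=
  GRing.Zmodule_isComNzRing.Build (fps R)
    (@fps_mulA R) (@fps_mulC R) (@fps_mul1 R) (@fps_mulDl R) (@fps_one_neq0 R).

Lemma fcoef0 (R : zmodType) m : fcoef (0 : fps R) m = 0.
Proof. by []. Qed.
Lemma fcoefN (R : zmodType) (f : fps R) m : fcoef (- f) m = - fcoef f m.
Proof. by []. Qed.
Lemma fcoefD (R : zmodType) (f g : fps R) m :
  fcoef (f + g) m = fcoef f m + fcoef g m.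
Proof. by []. Qed.
Lemma fcoef1 (R : comUnitRingType) m : fcoef (1 : fps R) m = (m == 0)%N%:R.
Proof. by []. Qed.
Lemma fcoefM (R : comUnitRingType) (f g : fps R) m :
  fcoef (f * g) m = \sum_(j < m.+1) fcoef f j * fcoef g (m - j).
Proof. by []. Qed.
Lemma fcoef_sum (R : zmodType) (I : Type) (s : seq I) (P : pred I)
  (F : I -> fps R) m :
  fcoef (\sum_(i <- s | P i) F i) m = \sum_(i <- s | P i) fcoef (F i) m.
Proof. by apply: (big_morph (fun f => fcoef f m)). Qed.

Definition fpsC (R : comUnitRingType) (a : R) : fps R :=
  Fps (fun m => if m is 0 then a else 0).

Lemma fcoefCM (R : comUnitRingType) (a : R) (f : fps R) m :
  fcoef (fpsC a * f) m = a * fcoef f m.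
Proof.
by rewrite fcoefM big_ord_recl subn0 big1 ?addr0 //= => j _; rewrite mul0r.
Qed.

Definition fps_unit (R : comUnitRingType) : {pred fps R} :=
  fun f => fcoef f 0 \is a GRing.unit.

(** If [f = a (1 - g)] with [a] the constant coefficient, then [g] has no
    constant term, so the geometric series for [1 / (1 - g)] contributes to the
    coefficient of degree [m] only through the powers [g ^+ k], [k <= m]. *)
Definition fps_inv (R : comUnitRingType) (f : fps R) : fps R :=
  if f \in @fps_unit R then
    let g := 1 - fpsC (fcoef f 0)^-1 * f in
    fpsC (fcoef f 0)^-1 * Fps (fun m => fcoef (\sum_(k < m.+1) g ^+ k) m)
  else f.

Lemma fcoef_exp_small (R : comUnitRingType) (g : fps R) k m :
  fcoef g 0 = 0 -> (m < k)%N -> fcoef (g ^+ k) m = 0.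
Proof.
move=> g0; elim: k m => // k IHk m ltmk; rewrite exprS fcoefM big1 // => j _.
have [->|j_gt0] := posnP j; first by rewrite g0 mul0r.
rewrite IHk ?mulr0 //; apply: (@leq_trans m); last by rewrite -ltnS.
by rewrite ltn_subrL j_gt0 (leq_trans j_gt0) // -ltnS.
Qed.

Lemma fps_mulV (R : comUnitRingType) :
  {in @fps_unit R, left_inverse 1 (@fps_inv R) *%R}.
Proof.
move=> f Uf; rewrite /fps_inv Uf; set a := fcoef f 0.
have Ua : a \is a GRing.unit by [].
set g := 1 - fpsC a^-1 * f; set S := Fps _.
have g0 : fcoef g 0 = 0 by rewrite fcoefD fcoefN fcoefCM mulVr // subrr.
have -> : fpsC a^-1 * S * f = S * (1 - g).
  by rewrite /g subKr mulrA [S * _]mulrC.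
apply: fpsP => m; rewrite [in LHS]mulrC fcoefM.
transitivity (fcoef ((1 - g) * \sum_(k < m.+1) g ^+ k) m).
  rewrite fcoefM; apply: eq_bigr => j _; congr (_ * _).
  rewrite /S /= !fcoef_sum (big_ord_widen m.+1 (fun k => fcoef (g ^+ k) _)).
    rewrite big_mkcond; apply: eq_bigr => k _; case: ifPn => //.
    by rewrite -leqNgt => ltk; rewrite fcoef_exp_small.
  by rewrite ltnS leq_subr.
have -> : (1 - g) * \sum_(k < m.+1) g ^+ k = 1 - g ^+ m.+1.
  have := subrX1 g m.+1; move: (g) (\sum_(_ < _) _) => h t eqh.
  by rewrite -(opprB (h ^+ _) 1) eqh -mulNr opprB.
by rewrite fcoefD fcoefN fcoef_exp_small // subr0.
Qed.

Lemma fps_unitPl (R : comUnitRingType) (f g : fps R) :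
  g * f = 1 -> f \in @fps_unit R.
Proof.
move=> /(congr1 (fun h => fcoef h 0%N)); rewrite fcoefM big_ord1 => gf1.
by apply/unitrPr; exists (fcoef g 0); rewrite mulrC.
Qed.

Lemma fps_inv_out (R : comUnitRingType) :
  {in [predC @fps_unit R], @fps_inv R =1 id}.
Proof. by move=> f /negPf /= Uf; rewrite /fps_inv Uf. Qed.

HB.instance Definition _ (R : comUnitRingType) :=
  GRing.ComNzRing_hasMulInverse.Build (fps R)
    (@fps_mulV R) (@fps_unitPl R) (@fps_inv_out R).

Definition fpsX (R : comUnitRingType) : fps R :=
  Fps (fun m => (m == 1)%N%:R).

Definition qpoch (A : comNzRingType) (a x : A) (n : nat) : A :=
  \prod_(1 <= j < n.+1) (1 - a * x ^+ j.-1).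

(** [fset_set] sends infinite sets to [fset0], so this is meaningful only when
    every level set of the weight [w] on [S] is finite; for cylindric partitions
    this is [finite_cylindric] below. *)
Definition genfun (T : choiceType) (S : set T) (w : T -> nat) : fps int :=
  Fps (fun m => (#|` fset_set [set x | S x /\ w x = m]%classic |)%:R).

(** Rows and parts are numbered from [0]: row [i : 'I_r] is the [(i+1)]-st row
    and [nth 0 s j] the [(j+1)]-st part of [s].  The parts of a composition of
    [l] are at most [l], hence the codomain ['I_l.+1]. *)
Definition compositions (r l : nat) : {set {ffun 'I_r -> 'I_l.+1}} :=
  [set d : {ffun 'I_r -> 'I_l.+1} | \sum_(i < r) (d i : nat) == l]%N.

Definition is_partition (s : seq nat) : bool := sorted geq s && (0%N \notin s).

(** [ordS i] is the cyclic successor of [i], so the instance [i = r - 1] of the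
    second clause compares the last row with the first. *)
Definition cylindric (r l : nat) (c : {ffun 'I_r -> 'I_l.+1})
    (L : {ffun 'I_r -> seq nat}) : Prop :=
  (forall i, is_partition (L i)) /\
  (forall i j, nth 0 (L (ordS i)) (j + c (ordS i)) <= nth 0 (L i) j)%N.

Definition cyl_size (r : nat) (L : {ffun 'I_r -> seq nat}) : nat :=
  (\sum_(i < r) \sum_(p <- L i) p)%N.

Definition cyl_max (r : nat) (L : {ffun 'I_r -> seq nat}) : nat :=
  (\max_(i < r) \max_(p <- L i) p)%N.

Definition f_le (r l n : nat) (d : {ffun 'I_r -> 'I_l.+1}) : fps int :=
  genfun [set L | cylindric d L /\ forall i p, p \in L i -> (p <= n)%N]%classic
    (@cyl_size r).

Definition f_eq (r l n : nat) (c : {ffun 'I_r -> 'I_l.+1}) : fps int :=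
  genfun [set L | cylindric c L /\ cyl_max L = n]%classic (@cyl_size r).

Definition P_le (r l n : nat) (d : {ffun 'I_r -> 'I_l.+1}) : fps int :=
  qpoch (fpsX int ^+ r) (fpsX int ^+ r) n * f_le n d.

Definition Delta (r l : nat) (c d : {ffun 'I_r -> 'I_l.+1}) : int :=
  \sum_(k < r | (0 < k)%N) k%:Z * ((d k)%:Z - (c k)%:Z) +
  r%:Z * \big[Num.max/0]_(i < r | (0 < i)%N)
           (\sum_(k < r | (i <= k)%N) (c k)%:Z -
            \sum_(k < r | (i <= k)%N) (d k)%:Z).

(** The exponent [n * Delta c d] is an integer, nonnegative by
    [Delta_ge0] below. *)
Definition P_eq (r l n : nat) (c : {ffun 'I_r -> 'I_l.+1}) : fps int :=
  if n is n'.+1 then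
    fpsX int ^+ (n * r) * P_le n' c +
    \sum_(d in compositions r l | d != c)
      fpsX int ^ (n%:Z * Delta c d) * P_le n' d
  else 1.

Lemma finite_cylindric (r l : nat) (c : {ffun 'I_r -> 'I_l.+1}) (m : nat) :
  finite_set [set L | cylindric c L /\ cyl_size L = m]%classic.
Proof.
pose g (h : {ffun 'I_r -> m.-bseq 'I_m.+1}) : {ffun 'I_r -> seq nat} :=
  [ffun i => map val (h i : seq 'I_m.+1)].
apply: (@sub_finite_set _ _ (range g)); last first.
  exact: finite_image (@finite_finset _ _).
move=> L [[Lpart _] Lm] /=.
have rowm i : (\sum_(p <- L i) p <= m)%N.
  by rewrite -Lm /cyl_size (bigD1 i) //= leq_addr.
have szm i : (size (L i) <= m)%N.
  apply: leq_trans (rowm i); have /andP[_] := Lpart i.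
  elim: (L i) => // p s IHs; rewrite inE negb_or big_cons => /andP[p0 s0].
  by rewrite /= -add1n leq_add ?IHs // lt0n eq_sym.
have partm i p : p \in L i -> (p <= m)%N.
  by move=> Lp; apply: leq_trans (rowm i); rewrite (big_rem p) //= leq_addr.
have szm' i : (size (map (@inord m) (L i)) <= m)%N by rewrite size_map.
exists [ffun i => Bseq (szm' i)] => //; apply/ffunP => i; rewrite !ffunE /=.
rewrite -map_comp map_id_in // => p Lp.
by rewrite /= inordK // ltnS (partm i).
Qed.

Lemma Delta_ge0 (r l : nat) (c d : {ffun 'I_r -> 'I_l.+1}) : 0 <= Delta c d.
Proof.
pose S (i : 'I_r) : int := \sum_(k < r | (i <= k)%N) ((c k)%:Z - (d k)%:Z).
rewrite /Delta.
have -> : \sum_(k < r | (0 < k)%N) k%:Z * ((d k)%:Z - (c k)%:Z)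
          = - \sum_(i < r | (0 < i)%N) S i.
  rewrite /S (exchange_big_dep (fun k : 'I_r => 0 < k)%N) /=; last first.
    by move=> i k /leq_trans; apply.
  rewrite -sumrN; apply: eq_bigr => k k0.
  rewrite sumr_const -mulr_natl -mulrN opprB natz; congr (_%:Z * _).
  have ltr (i : 'I_k) : (i.+1 < r)%N.
    by apply: leq_trans (ltn_ord k); rewrite ltnS.
  have inj : injective (fun i => Ordinal (ltr i)) by move=> i j [/val_inj].
  rewrite -[LHS](card_ord k) -(card_imset _ inj).
  apply: eq_card => i; apply/imsetP/andP => [[j _ ->]|].
    by split=> //=; apply: ltn_ord.
  case: i => [[|i] lti] /= [] // _ leik.
  by exists (Ordinal leik) => //; apply: val_inj.
have maxE : \big[Num.max/0]_(i < r | (0 < i)%N)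
     (\sum_(k < r | (i <= k)%N) (c k)%:Z - \sum_(k < r | (i <= k)%N) (d k)%:Z)
   = \big[Num.max/0]_(i < r | (0 < i)%N) S i.
  by apply: eq_bigr => i _; rewrite /S sumrB.
rewrite maxE; set M := \big[Num.max/0]_(i < r | _) _.
have M0 : 0 <= M.
  by rewrite /M; elim/big_rec: _ => // i x _ x0; rewrite le_max x0 orbT.
have SM (i : 'I_r) : (0 < i)%N -> S i <= M by move=> i0; apply: le_bigmax_cond.
rewrite addrC subr_ge0 big_mkcond /=.
rewrite -[leRHS]/(r%:Z * M) -[r in leRHS]card_ord -natz mulr_natl -sumr_const.
by apply: ler_sum => i _; case: ifPn => // /SM.
Qed.

(* Main.v *)
Require Import Defs.
From mathcomp Require Import all_boot all_order all_algebra.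
From mathcomp Require Import finmap zify.
From mathcomp Require Import boolp classical_sets functions cardinality.

Set Implicit Arguments.
Unset Strict Implicit.
Unset Printing Implicit Defensive.

Import Order.TTheory GRing.Theory Num.Theory.

Local Open Scope ring_scope.

(** Let [N > 0] and let [L] have profile [c] and largest part [N], and let [m i]
    be the number of parts [N] in row [i].  Deleting these parts leaves a
    cylindric partition with parts [< N], whose profile [d] satisfies
    [d_{i+1} + m_{i+1} = c_{i+1} + m_i] (cyclically).  Given [d], this determines
    [m] up to an additive constant, and the solution with minimum [0] has sum
    [Delta c d].  So the [L] in which some row misses [N] are counted by
    [\sum_(d != c) q^(N Delta(c, d)) f_{N-1,d}].  When [N] occurs in every row,
    deleting one [N] per row gives an arbitrary cylindric partition of profile
    [c] with parts [<= N], hence the term [q^(N r) (f_{=N,c} + f_{N-1,c})].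
    Solving for [f_{=N,c}] yields the recurrence. *)

(** * Multiplication of a power series by powers of the variable *)

Lemma fcoefXM (R : comUnitRingType) (f : fps R) m :
  fcoef (fpsX R * f) m = if m is m'.+1 then fcoef f m' else 0.
Proof.
rewrite fcoefM big_ord_recl /= mul0r add0r; case: m => [|m].
  by rewrite big_ord0.
rewrite big_ord_recl /= mul1r subSS subn0 big1 ?addr0 // => j _.
by rewrite mul0r.
Qed.

Lemma fcoefXnM (R : comUnitRingType) (f : fps R) k m :
  fcoef (fpsX R ^+ k * f) m = if (k <= m)%N then fcoef f (m - k) else 0.
Proof.
elim: k m => [|k IHk] [|m]; rewrite ?expr0 ?mul1r ?subn0 //.
  by rewrite exprS -mulrA fcoefXM.
by rewrite exprS -mulrA fcoefXM IHk subSS.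
Qed.

(** * Generating functions under weight-shifting bijections and set partitions *)

Section GeneratingFunctions.
Local Open Scope classical_set_scope.

(** The condition under which the coefficients of [genfun] really count, since [fset_set] empties
    infinite sets. *)
Definition finite_levels (T : choiceType) (S : set T) (w : T -> nat) : Prop :=
  forall m, finite_set [set x | S x /\ w x = m].

Lemma finite_levels_sub (T : choiceType) (S S' : set T) (w : T -> nat) :
  S `<=` S' -> finite_levels S' w -> finite_levels S w.
Proof.
by move=> sSS' fin m; apply: sub_finite_set (fin m) => x [/sSS'].
Qed.

Lemma genfun0 (T : choiceType) (w : T -> nat) : genfun set0 w = 0.
Proof.
apply: fpsP => m /=; rewrite (_ : [set x | _] = set0) ?fset_set0 //.
by apply/seteqP; split=> x // [].
Qed.

(** The level set of weight [m] in [S'] is the image of the one of weight [m - k] in [S], and is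
    empty for [m < k]; finiteness thus passes from [S] to [S']. *)
Lemma genfun_bij (T U : choiceType) (S : set T) (S' : set U) (w : T -> nat)
    (w' : U -> nat) (f : T -> U) (k : nat) :
  finite_levels S w -> set_bij S S' f ->
  (forall x, S x -> w' (f x) = (k + w x)%N) ->
  genfun S' w' = fpsX int ^+ k * genfun S w.
Proof.
move=> fin [funf injf surjf] wf; apply: fpsP => m; rewrite fcoefXnM /=.
case: leqP => [lekm|ltmk]; last first.
  rewrite (_ : [set x | _] = set0) ?fset_set0 //.
  apply/seteqP; split=> // y [Sy wy].
  by have [x Sx fx] := surjf y Sy; move: wy; rewrite -fx wf //= => wy; lia.
rewrite (_ : [set x | S' x /\ _] = f @` [set x | S x /\ w x = (m - k)%N]).
  rewrite fset_set_image //; congr (_%:R); apply: card_in_imfset => x y /=.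
  rewrite !in_fset_set // !inE => -[Sx _] [Sy _].
  by apply: injf; rewrite inE.
apply/seteqP; split=> [y [Sy wy]|y [x [Sx wx] <-]] /=.
  have [x Sx fx] := surjf y Sy; exists x => //; split=> //.
  by move: wy; rewrite -fx wf //; lia.
by split; [exact: funf | rewrite wf // wx subnKC].
Qed.

Lemma genfun_partition (T : choiceType) (D : finType) (S : set T)
    (w : T -> nat) (key : T -> D) :
  finite_levels S w ->
  genfun S w = \sum_d genfun [set x | S x /\ key x = d] w.
Proof.
move=> fin; apply: fpsP => m; rewrite fcoef_sum /= -natr_sum; congr (_%:R).
rewrite -sum1_size (partition_big key xpredT) //=; apply: eq_bigr => d _.
rewrite -big_filter sum1_size; apply: perm_size; apply: uniq_perm.
- exact/filter_uniq/fset_uniq.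
- exact: fset_uniq.
have find : finite_levels [set x | S x /\ key x = d] w.
  by apply: finite_levels_sub fin => x [].
move=> x; rewrite mem_filter !in_fset_set //.
apply/andP/idP; rewrite !inE /=.
  by case=> /eqP <- [].
by case=> -[Sx /eqP kx] wx; split.
Qed.

Lemma genfun_split (T : choiceType) (S P : set T) (w : T -> nat) :
  finite_levels S w ->
  genfun S w = genfun (S `&` P) w + genfun (S `\` P) w.
Proof.
move=> /(genfun_partition (fun x => `[< P x >])) ->; rewrite big_bool.
congr (genfun _ w + genfun _ w); apply/seteqP; split=> x [Sx Px]; split=> //;
  by [exact/asboolP | apply/asboolPn; rewrite Px].
Qed.

End GeneratingFunctions.

(** * Adding and deleting copies of the largest part, row by row *)

Section Stack.
Variable r : nat.
Implicit Types (L : {ffun 'I_r -> seq nat}) (m : 'I_r -> nat).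

Definition parts_le n L : Prop := forall i p, p \in L i -> (p <= n)%N.

Lemma cyl_max_leP n L : (cyl_max L <= n)%N <-> parts_le n L.
Proof.
split=> [/bigmax_leqP le i p Lp|le].
  by have /bigmax_leqP_seq := le i isT; apply.
by apply/bigmax_leqP => i _; apply/bigmax_leqP_seq => p Lp _; apply: le Lp.
Qed.

Lemma cyl_max_eqSP n L :
  cyl_max L = n.+1 <-> parts_le n.+1 L /\ ~ parts_le n L.
Proof. by rewrite -!cyl_max_leP; lia. Qed.

Lemma parts_le_count n L :
  parts_le n.+1 L -> (parts_le n L <-> forall i, count_mem n.+1 (L i) = 0%N).
Proof.
move=> le; split=> [le' i|c0 i p Lp].
  by apply/count_memPn/negP => /le'; rewrite ltnn.
have := le i p Lp; rewrite leq_eqVlt => /predU1P[pn|//].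
by move: Lp; rewrite pn -has_pred1 has_count c0.
Qed.

Lemma is_partition_cons n s : is_partition (n :: s) =
  [&& (0 < n)%N, all (geq n) s & is_partition s].
Proof.
rewrite /is_partition /= path_sortedE; last by move=> x y z /= yx xz; lia.
by rewrite inE negb_or eq_sym -lt0n -!andbA; do !bool_congr.
Qed.

Lemma is_partition_nseq_cat k n s :
  (0 < n)%N -> all (geq n) s -> is_partition (nseq k n ++ s) = is_partition s.
Proof.
move=> n0 sn; elim: k => //= k IHk; rewrite is_partition_cons n0 IHk all_cat sn.
by rewrite all_nseq /= leqnn orbT.
Qed.

(** In a weakly decreasing sequence bounded by [n] all copies of [n] stand first. *)
Lemma partition_unstack n k s :
  is_partition s -> all (geq n) s -> (k <= count_mem n s)%N ->
  s = nseq k n ++ drop k s.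
Proof.
elim: k s => [|k IHk] [|x s] //=.
rewrite is_partition_cons => /and3P[_ xs ps] /andP[xn sn] kc.
have xE : x = n.
  apply/eqP; case: eqP kc => // neq; rewrite add0n => k_lt.
  have ns : n \in s by rewrite -has_pred1 has_count (leq_trans _ k_lt).
  by have /= := allP xs _ ns; move: xn => /=; lia.
by rewrite -IHk // ?xE //; rewrite xE eqxx in kc.
Qed.

(** The deleted prefix already accounts for every occurrence of [n]; another one in the tail would
    contradict the count. *)
Lemma drop_count_lt n s :
  is_partition s -> all (geq n) s -> all (gtn n) (drop (count_mem n s) s).
Proof.
move=> ps sn; have /= e := partition_unstack ps sn (leqnn _).
apply/allP => x xs /=; have /= := allP sn x (mem_drop xs).
rewrite leq_eqVlt => /predU1P[xn|//].
have := congr1 (count_mem n) e; rewrite count_cat count_nseq /= eqxx mul1n.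
rewrite -[X in X = _]addn0 => /addnI /esym/eqP.
rewrite -leqn0 leqNgt -has_count.
by rewrite has_pred1 -{1}xn xs.
Qed.

Definition stack m n L : {ffun 'I_r -> seq nat} :=
  [ffun i => nseq (m i) n ++ L i].

Lemma stack_inj m n : injective (stack m n).
Proof.
move=> L L' /ffunP e; apply/ffunP => i; have := e i; rewrite !ffunE => /eqP.
by rewrite eqseq_cat // eqxx => /eqP.
Qed.

Lemma parts_le_stack m n L : parts_le n L -> parts_le n (stack m n L).
Proof.
by move=> le i p; rewrite ffunE mem_cat mem_nseq => /orP[/andP[_ /eqP->]|/le].
Qed.

Lemma cyl_size_stack m n L :
  cyl_size (stack m n L) = (n * \sum_i m i + cyl_size L)%N.
Proof.
rewrite /cyl_size big_distrr -big_split; apply: eq_bigr => i _ /=.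
by rewrite ffunE big_cat /= big_nseq iter_addn_0.
Qed.

Lemma count_stack m n L i :
  parts_le n L -> count_mem n.+1 (stack m n.+1 L i) = m i.
Proof.
move=> le; rewrite ffunE count_cat count_nseq /= eqxx mul1n.
by rewrite (count_memPn _) ?addn0 //; apply/negP => /le; rewrite ltnn.
Qed.

Lemma unstack m n L :
  (forall i, is_partition (L i)) -> parts_le n L ->
  (forall i, m i <= count_mem n (L i))%N ->
  L = stack m n [ffun i => drop (m i) (L i)].
Proof.
move=> pL le mL; apply/ffunP => i; rewrite !ffunE.
apply: partition_unstack => //.
by apply/allP => p /le.
Qed.

(** * The change of profile caused by stacking *)

Variable l : nat.
Implicit Types (c d : {ffun 'I_r -> 'I_l.+1}).

(** [d] is the profile that remains once the [m i] largest parts are deleted from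
    each row [i] of a cylindric partition of profile [c]. *)
Definition profile_shift c d m : Prop :=
  forall i, (d (ordS i) + m (ordS i) = c (ordS i) + m i)%N.

(** Past its first [m i] entries, row [i] of the stack is row [i] of [L] shifted by [m i], which
    turns the offset [c] into [d]. Comparisons with the first [m i] entries hold because [n] bounds
    everything. *)
Lemma cylindric_stack c d m n L :
  (0 < n)%N -> parts_le n L -> profile_shift c d m ->
  cylindric c (stack m n L) <-> cylindric d L.
Proof.
move=> n0 le cdm.
have partE i : is_partition (stack m n L i) = is_partition (L i).
  by rewrite ffunE is_partition_nseq_cat //; apply/allP => p /le.
have nthE i j : nth 0%N (stack m n L i) j
    = if (j < m i)%N then n else nth 0%N (L i) (j - m i).
  by rewrite ffunE nth_cat size_nseq nth_nseq; case: ltnP.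
have nth_le i j : (nth 0%N (L i) j <= n)%N.
  case: (ltnP j (size (L i))) => [lt|ge]; last by rewrite nth_default.
  by apply: le (mem_nth _ lt).
split=> -[pL cL]; split=> [i|i j].
- by rewrite -partE.
- have := cL i (j + m i)%N; have := cdm i; rewrite !nthE => e.
  rewrite !ifF; try lia.
  have -> : (j + m i + c (ordS i) - m (ordS i) = j + d (ordS i))%N by lia.
  by rewrite addnK.
- by rewrite partE.
rewrite !nthE; case: (ltnP j (m i)) => [_|le_mj].
  by case: ifP.
have := cdm i; have := cL i (j - m i)%N => lei e.
rewrite ifF; last lia.
by have -> : (j + c (ordS i) - m (ordS i) = j - m i + d (ordS i))%N by lia.
Qed.

(** Subtracting the two systems shows that [m - m'] is constant along the rows. As both are
    nonnegative and vanish somewhere, the constant is 0. *)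
Lemma profile_shift_eq c d m m' :
  profile_shift c d m -> profile_shift c d m' ->
  (exists i, m i = 0%N) -> (exists i, m' i = 0%N) -> m =1 m'.
Proof.
move=> cdm cdm' [i0 mi0] [i1 mi1].
have r0 : (0 < r)%N by exact: leq_ltn_trans (leq0n i0) (ltn_ord i0).
have const i : (m i + m' (Ordinal r0) = m (Ordinal r0) + m' i)%N.
  case: i; elim=> [|k IHk] ltk.
    by have -> : Ordinal ltk = Ordinal r0 by apply: val_inj.
  have {}IHk := IHk (ltnW ltk); set i := Ordinal (ltnW ltk) in IHk.
  have -> : Ordinal ltk = ordS i by apply: val_inj; rewrite /= modn_small.
  by have := cdm i; have := cdm' i; lia.
by move=> i; have := const i; have := const i0; have := const i1; lia.
Qed.

(** The prescribed increments of [m] add up to 0 around the cycle, because [c] and [d] have the same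
    sum; it remains to normalise the minimum to 0. *)
Lemma profile_shift_exists c d :
  (0 < r)%N -> c \in compositions r l -> d \in compositions r l ->
  exists m, [/\ profile_shift c d m, exists i, m i = 0%N
              & (\sum_i m i)%N%:Z = Delta c d].
Proof.
move=> r0; rewrite !inE => /eqP sc /eqP sd.
(* The solution whose last entry is the maximum [M] in [Delta] is [M - T i.+1]. *)
pose T (i : nat) : int := \sum_(k < r | (i <= k)%N) ((c k)%:Z - (d k)%:Z).
have TS (i : 'I_r) : T i = (c i)%:Z - (d i)%:Z + T i.+1.
  rewrite /T (bigD1 i) //=; congr (_ + _); apply: eq_bigl => k.
  by rewrite ltn_neqAle andbC eq_sym.
have T0 : T 0 = 0.
  rewrite /T sumrB -!(big_morph Posz PoszD (erefl _)) /=.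
  by rewrite sc sd subrr.
have Tr : T r = 0.
  by rewrite /T big_pred0 // => k; rewrite leqNgt ltn_ord.
rewrite /Delta; set M := \big[Num.max/0]_(i < r | _) _.
have ME : M = \big[Num.max/0]_(i < r | (0 < i)%N) T i.
  by apply: eq_bigr => i _; rewrite /T sumrB.
have M0 : 0 <= M.
  by rewrite ME; elim/big_rec: _ => // i x _ x0; rewrite le_max x0 orbT.
have TM (i : 'I_r) : T i.+1 <= M.
  have [lt|ge] := ltnP i.+1 r; last first.
    by rewrite (_ : i.+1 = r) ?Tr //; have := ltn_ord i; lia.
  rewrite ME.
  exact: (@le_bigmax_cond _ _ _ _ (Ordinal lt) _ (fun i : 'I_r => T i)).
pose m (i : 'I_r) := `|M - T i.+1|%N.
have mE i : (m i)%:Z = M - T i.+1 by rewrite /m gez0_abs // subr_ge0.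
exists m; split.
- move=> i.
  suff : (d (ordS i))%:Z + (m (ordS i))%:Z = (c (ordS i))%:Z + (m i)%:Z by lia.
  rewrite !mE; have := TS (ordS i); suff -> : T (ordS i) = T i.+1 by lia.
  have [lt|ge] := ltnP i.+1 r; first by rewrite /= modn_small.
  have e : i.+1 = r by have := ltn_ord i; lia.
  by rewrite /= e modnn T0 Tr.
- suff [i Ti] : exists i : 'I_r, T i.+1 = M by exists i; rewrite /m Ti subrr.
  (* The default 0 of the maximum is the value [T r], hence an index in ['I_r.+1]. *)
  have [i0 M_eq]: exists i : 'I_r.+1, M = T i.
    rewrite ME; elim/big_rec: _ => [|i x _ [j ->]].
      by exists ord_max; rewrite Tr.
    by case: leP => _; [exists j | exists (widen_ord (leqnSn r) i)].
  (* Index 0 is no successor, but [T 0 = T r], so the last row serves instead. *)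
  have [i0_eq|i0_gt] := posnP i0.
    have lt : (r.-1 < r)%N by lia.
    by exists (Ordinal lt); rewrite /= prednK // Tr M_eq i0_eq T0.
  have lt : (i0.-1 < r)%N by have := ltn_ord i0; lia.
  by exists (Ordinal lt); rewrite /= prednK // M_eq.
rewrite (big_morph Posz PoszD (erefl _)) (eq_bigr _ (fun i _ => mE i)) sumrB.
rewrite sumr_const card_ord -mulr_natl natz addrC; congr (_ + _).
(* The difference at [k] occurs in [T i.+1] exactly for [i < k], that is [k] times. *)
rewrite /T (exchange_big_dep (fun k : 'I_r => 0 < k)%N) /=; last first.
  by move=> i k _ /(leq_ltn_trans _); apply.
rewrite -sumrN; apply: eq_bigr => k k0.
rewrite sumr_const -mulr_natl -mulrN opprB natz; congr (_%:Z * _).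
rewrite -sum1_card (eq_bigl (fun i : 'I_r => i < k)%N) //.
rewrite -(big_ord_widen r (fun=> 1%N)); last exact: ltnW.
by rewrite sum1_card card_ord.
Qed.

End Stack.

(** * The recurrence for the series with prescribed maximum *)

Section Recurrence.
Variables r l : nat.
Implicit Types (c d : {ffun 'I_r -> 'I_l.+1}) (L : {ffun 'I_r -> seq nat}).

Lemma nth_partition_max n s j :
  (0 < n)%N -> is_partition s -> all (geq n) s ->
  (n <= nth 0%N s j)%N = (j < count_mem n s)%N.
Proof.
move=> n0 ps sn; rewrite {1}(partition_unstack ps sn (leqnn _)).
rewrite nth_cat size_nseq nth_nseq; case: ltnP => //= _; first exact: leqnn.
apply/negbTE; rewrite -ltnNge; have /allP sdrop := drop_count_lt ps sn.
set t := drop _ s in sdrop *; set i := (j - _)%N.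
by case: (ltnP i (size t)) => ?; [exact/sdrop/mem_nth | rewrite nth_default].
Qed.

(** This is the equation of [profile_shift] solved for [d]. By [remaining_profileP], neither the
    truncated subtraction nor [inord] distorts the value when [L] is cylindric with parts at most
    [n]. *)
Definition remaining_profile n c L : {ffun 'I_r -> 'I_l.+1} :=
  [ffun i => inord (c i + count_mem n (L (ord_pred i)) - count_mem n (L i))].

Lemma remaining_profileP n c L :
  (0 < n)%N -> c \in compositions r l -> cylindric c L -> parts_le n L ->
  profile_shift c (remaining_profile n c L) (fun i => count_mem n (L i)) /\
  remaining_profile n c L \in compositions r l.
Proof.
move=> n0; rewrite !inE => /eqP sc [pL cL] le.
have all_le i : all (geq n) (L i) by apply/allP => p /le.
pose m i := count_mem n (L i).
have m_leS i : (m (ordS i) <= c (ordS i) + m i)%N.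
  (* Otherwise the entry of row [ordS i] at index [c (ordS i) + m i] is [n], and the cylindric
     inequality puts an [n] at index [m i] of row [i], beyond its last copy. *)
  rewrite leqNgt; apply/negP; rewrite addnC -nth_partition_max // => le_n.
  by have := leq_trans le_n (cL _ _); rewrite nth_partition_max // ltnn.
have m_le i : (m i <= c i + m (ord_pred i))%N.
  by have := m_leS (ord_pred i); rewrite ord_predK.
have se : (\sum_i (c i + m (ord_pred i) - m i) = l)%N.
  rewrite sumnB // big_split /= sc.
  rewrite [X in (_ - X)%N](reindex_inj (@ord_pred_inj r)).
  by rewrite addnK.
have e_le i : (c i + m (ord_pred i) - m i <= l)%N.
  by rewrite -[leqRHS]se (bigD1 i) //= leq_addr.
have valE i : remaining_profile n c L i = (c i + m (ord_pred i) - m i)%N :> nat.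
  by rewrite ffunE inordK // ltnS e_le.
split=> [i|]; first by rewrite valE ordSK subnK ?m_leS.
by rewrite -[X in _ == X]se; apply/eqP/eq_bigr => i _; rewrite valE.
Qed.

Lemma profile_shift_inj c d d' (m : 'I_r -> nat) :
  profile_shift c d m -> profile_shift c d' m -> d = d'.
Proof.
move=> cd cd'; apply/ffunP => i; apply: val_inj => /=.
rewrite -[i]ord_predK; have := cd (ord_pred i); have := cd' (ord_pred i).
lia.
Qed.

Lemma profile_shift_refl c k : profile_shift c c (fun=> k).
Proof. by []. Qed.

Lemma cylindric_levels c (P : set {ffun 'I_r -> seq nat}) :
  finite_levels [set L | cylindric c L /\ P L]%classic (@cyl_size r).
Proof.
apply: (@finite_levels_sub _ _ [set L | cylindric c L]%classic) => [L []//|].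
exact: finite_cylindric.
Qed.

Lemma f_leS n c : f_le n.+1 c = f_eq n.+1 c + f_le n c.
Proof.
rewrite /f_le (genfun_split [set L | cyl_max L = n.+1]%classic); last first.
  exact: cylindric_levels.
rewrite /f_eq; congr (_ + _); congr genfun; apply/seteqP; split=> L /=.
- by case=> -[].
- by case=> cL mL; have /cyl_max_eqSP[] := mL.
- case=> -[cL le] nmL; split=> //; apply: contrapT => nle.
  by apply: nmL; apply/cyl_max_eqSP.
case=> cL le; have le' : parts_le n.+1 L by move=> i p /le /leqW.
by split=> // /cyl_max_eqSP[_]; apply.
Qed.

Lemma f_eqS n c :
  (0 < r)%N -> c \in compositions r l ->
  f_eq n.+1 c = fpsX int ^+ (n.+1 * r) * f_le n.+1 c +
    \sum_(d in compositions r l | d != c)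
      fpsX int ^ (n.+1%:Z * Delta c d) * f_le n d.
Proof.
move=> r0 cC; rewrite /f_eq.
rewrite (genfun_split
  [set L : {ffun 'I_r -> seq nat} | forall i, n.+1 \in L i]%classic); last first.
  exact: cylindric_levels.
congr (_ + _).
  (* A constant [m] keeps the profile. Copies of [n.+1] may survive the deletion, so the bound on
     the parts stays [n.+1]. *)
  apply: (genfun_bij (f := stack (fun=> 1%N) n.+1)).
  - exact: cylindric_levels.
  - split=> [L [cL le]|L L' _ _|L [[cL /cyl_max_eqSP[le _]] allL]] /=.
    + have memL i : n.+1 \in stack (fun=> 1%N) n.+1 L i.
        by rewrite ffunE inE eqxx.
      split=> //; split.
        exact/(cylindric_stack _ le (@profile_shift_refl c 1)).
      apply/cyl_max_eqSP; split; first exact: parts_le_stack.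
      by move/(_ (Ordinal r0) _ (memL _)); rewrite ltnn.
    + exact: stack_inj.
    have e : L = stack (fun=> 1%N) n.+1 [ffun i => drop 1 (L i)].
      apply: unstack => // [|i]; first by case: cL.
      by rewrite -has_count has_pred1 allL.
    have le1 : parts_le n.+1 [ffun i => drop 1 (L i)].
      by move=> i p; rewrite ffunE => /mem_drop /le.
    exists [ffun i => drop 1 (L i)] => //; split=> //.
    by apply/(cylindric_stack _ le1 (@profile_shift_refl c 1)) => //; rewrite -e.
  by move=> L _; rewrite cyl_size_stack sum_nat_const card_ord muln1.
rewrite (genfun_partition (remaining_profile n.+1 c)); last first.
  by apply: finite_levels_sub (@cylindric_levels c setT) => L [[]].
rewrite [RHS]big_mkcond /=; apply: eq_bigr => d _.
(* Other [d] give an empty class: the remaining profile is always a composition, and if it is [c]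
   the multiplicities are constant, hence 0 because some row misses [n.+1], against the maximum. *)
case: ifPn => [/andP[dC dc]|notd]; last first.
  rewrite -[RHS](@genfun0 _ (@cyl_size r)); congr genfun.
  apply/seteqP; split=> // L [[[cL /cyl_max_eqSP[le nle]] allL] dE].
  have [//|sh] := remaining_profileP _ cC cL le; rewrite dE => dC.
  rewrite dC negbK /= in notd; rewrite dE (eqP notd) in sh.
  apply/nle/parts_le_count => // i.
  apply: (profile_shift_eq sh (@profile_shift_refl c 0)); last by exists i.
  have [j nj] := (existsNP _).2 allL; exists j.
  by apply/count_memPn/negP.
(* Since every [L] of this class has a row without [n.+1], its multiplicities must be this [m]. *)
have [m [sh m0 mDelta]] := profile_shift_exists r0 cC dC.
rewrite -mDelta -PoszM -exprnP; apply: (genfun_bij (f := stack m n.+1)).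
- exact: cylindric_levels.
- split=> [L [cL le]|L L' _ _|L [[[cL /cyl_max_eqSP[le nle]] allL] dE]] /=.
  + have le' : parts_le n.+1 L by move=> i p /le /leqW.
    have cst : cylindric c (stack m n.+1 L) by apply/(cylindric_stack _ le' sh).
    have lest : parts_le n.+1 (stack m n.+1 L) by apply: parts_le_stack.
    have countE : (fun i => count_mem n.+1 (stack m n.+1 L i)) = m.
      by apply/funext => i; rewrite count_stack.
    split; last first.
      have [//|+ _] := remaining_profileP _ cC cst lest.
      by rewrite countE => /profile_shift_inj; apply.
    split; last first.
      case: m0 => i mi /(_ i); rewrite -has_pred1 has_count.
      (* The count is beta-expanded so that [countE], an equality of functions, can rewrite it. *)
      rewrite -[count _ _]/((fun i => count_mem n.+1 (stack m n.+1 L i)) i).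
      by rewrite countE mi.
    split=> //; apply/cyl_max_eqSP; split=> // /(parts_le_count lest) c0.
    (* Without a part [n.+1] in the stack, [m] would be 0 and [d] would be [c]. *)
    case/eqP: dc; apply: (profile_shift_inj sh).
    have -> : m = fun=> 0%N by rewrite -countE; apply/funext.
    exact: profile_shift_refl.
  + exact: stack_inj.
  have [//|sh' _] := remaining_profileP _ cC cL le; rewrite dE in sh'.
  have mE : (fun i => count_mem n.+1 (L i)) = m.
    apply/funext/(profile_shift_eq sh' sh) => //.
    have [j nj] := (existsNP _).2 allL; exists j.
    by apply/count_memPn/negP.
  have pL i : is_partition (L i) by case: cL.
  pose L' : {ffun 'I_r -> seq nat} := [ffun i => drop (m i) (L i)].
  have e : L = stack m n.+1 L' by apply: unstack => // i; rewrite -mE.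
  have le' : parts_le n L'.
    have all_le i : all (geq n.+1) (L i) by apply/allP => q /le.
    move=> i p; rewrite ffunE -mE.
    by move=> /(allP (drop_count_lt (pL i) (all_le i))).
  exists L' => //; split=> //.
  have le'' : parts_le n.+1 L' by move=> i p /le' /leqW.
  by apply/(cylindric_stack _ le'' sh); rewrite -?e.
by move=> L _; rewrite cyl_size_stack.
Qed.

(** Parts are positive, so only the tuple of empty rows has maximum 0. *)
Lemma f_eq0 c : f_eq 0 c = 1.
Proof.
apply: fpsP => m; rewrite fcoef1 /=.
pose L0 : {ffun 'I_r -> seq nat} := [ffun=> [::]].
have sz0 : cyl_size L0 = 0%N.
  by rewrite /cyl_size big1 // => i _; rewrite ffunE big_nil.
have cyl0 : cylindric c L0 /\ cyl_max L0 = 0%N.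
  split; last by rewrite /cyl_max big1 // => i _; rewrite ffunE big_nil.
  by split=> [i|i j]; rewrite !ffunE ?nth_nil.
have only0 L : cylindric c L -> cyl_max L = 0%N -> L = L0.
  move=> [pL _] /eqP; rewrite -leqn0 => /cyl_max_leP le.
  apply/ffunP => i; rewrite ffunE; have /andP[_] := pL i; have := le i.
  by case: (L i) => // x s /(_ x (mem_head _ _)); rewrite leqn0 => /eqP ->.
case: eqP => [->|m0].
  rewrite (_ : [set L | _]%classic = [set L0]%classic) ?fset_set1 ?cardfs1 //.
  by apply/seteqP; split=> [L [[cL mL] _]|_ ->]; [exact: only0 | split].
rewrite (_ : [set L | _]%classic = set0) ?fset_set0 //.
apply/seteqP; split=> // L [[cL mL]]; rewrite (only0 L) // sz0 => /esym.
exact: m0.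
Qed.

End Recurrence.

(** * Normalisation by the product and conclusion *)

Lemma qpoch_unit (R : comUnitRingType) r n :
  (0 < r)%N -> qpoch (fpsX R ^+ r) (fpsX R ^+ r) n \is a GRing.unit.
Proof.
move=> r0; apply: rpred_prod => j _.
(* Units are the series with invertible constant term; here it is 1 because [r > 0]. *)
change (fcoef (1 - fpsX R ^+ r * fpsX R ^+ r ^+ j.-1) 0 \is a GRing.unit).
by rewrite fcoefD fcoefN fcoefXnM leqn0 (gtn_eqF r0) subr0 unitr1.
Qed.

Theorem theorem11 (r l : nat) (hr : (1 <= r)%N) (hl : (1 <= l)%N)
    (c : {ffun 'I_r -> 'I_l.+1}) (hc : c \in compositions r l) (n : nat) :
  f_eq n c = P_eq n c / qpoch (fpsX int ^+ r) (fpsX int ^+ r) n.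
Proof.
apply: (canRL (mulrK (qpoch_unit _ _ hr))).
case: n => [|n]; first by rewrite f_eq0 /qpoch big_geq // mulr1.
(* Splitting [f_le n.+1 c] in [f_eqS] makes [f_eq n.+1 c] appear on both sides; this is the equation
   solved for it. *)
have fE : f_eq n.+1 c * (1 - fpsX int ^+ (n.+1 * r)) =
    fpsX int ^+ (n.+1 * r) * f_le n c + \sum_(d in compositions r l | d != c)
      fpsX int ^ (n.+1%:Z * Delta c d) * f_le n d.
  rewrite mulrBr mulr1 {1}f_eqS // f_leS mulrDr -!addrA addrC.
  by rewrite [_ * f_eq _ _]mulrC -addrA addrNK addrC.
(* The last factor of the product is the one in [fE]; the others turn each [f_le n] into
   [P_le n]. *)
rewrite /qpoch big_nat_recr //= -exprS -exprM [(r * _)%N]mulnC.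
rewrite -/(qpoch (fpsX int ^+ r) (fpsX int ^+ r) n) mulrCA fE mulrDr mulr_sumr.
rewrite /P_le; congr (_ + _); first by rewrite mulrCA.
by apply: eq_bigr => d _; rewrite mulrCA.
Qed.
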